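(* Let $(M,\phi_\alpha,\xi_\alpha,\eta_\alpha,g)$, $\alpha\in\{1,2,3\}$, be a 3-quasi-Sasakian manifold of rank $4l+3$, and let $c$ be the constant such that $[\xi_\alpha,\xi_\beta]=c\,\xi_\gamma$ for every even permutation $(\alpha,\beta,\gamma)$ of $\{1,2,3\}$. Then for each $\alpha\in\{1,2,3\}$ and all vector fields $X,Y,Z$ on $M$, $$\begin{aligned} R_{XY}\phi_\alpha Z - \phi_\alpha R_{XY}Z = \frac{c^2}{4}\Bigl(&\bigl(\Psi_\alpha(Y,\psi_\alpha Z)-\eta_\alpha(Y)\eta_\alpha(Z)\bigr)\psi_\alpha X - \bigl(\Psi_\alpha(X,\psi_\alpha Z)-\eta_\alpha(X)\eta_\alpha(Z)\bigr)\psi_\alpha Y\\ &-\Psi_\alpha(Y,Z)\psi_\alpha^2 X + \Psi_\alpha(X,Z)\psi_\alpha^2Y\\ &+\bigl(\eta_\alpha(X)\Psi_\alpha(Y,Z)-\eta_\alpha(Y)\Psi_\alpha(X,Z)\bigr)\xi_\alpha\Bigr). \end{aligned}$$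
   Context: All manifolds are smooth and connected. An almost contact metric structure $(\phi,\xi,\eta,g)$ on $M$ consists of a $(1,1)$-tensor field $\phi$, a vector field $\xi$, a 1-form $\eta$ and a Riemannian metric $g$ with $\phi^2=-I+\eta\otimes\xi$, $\eta(\xi)=1$, $g(\phi X,\phi Y)=g(X,Y)-\eta(X)\eta(Y)$. Convention: $d\eta(X,Y)=X(\eta(Y))-Y(\eta(X))-\eta([X,Y])$. The structure is normal if $[\phi,\phi]+d\eta\otimes\xi=0$, where $[\phi,\phi]$ is the Nijenhuis torsion. Put $\Phi(X,Y)=g(X,\phi Y)$. The structure is quasi-Sasakian if it is normal and $d\Phi=0$. A quasi-Sasakian manifold has rank $2p+1$ if $\eta\wedge(d\eta)^p\neq0$ and $(d\eta)^{p+1}=0$ on $M$. A 3-quasi-Sasakian manifold is a manifold of dimension $4n+3$ with three quasi-Sasakian structures $(\phi_\alpha,\xi_\alpha,\eta_\alpha,g)$, $\alpha\in\{1,2,3\}$, with the same metric $g$, such that for every even permutation $(\alpha,\beta,\gamma)$ of $\{1,2,3\}$: $\phi_\gamma=\phi_\alpha\phi_\beta-\eta_\beta\otimes\xi_\alpha=-\phi_\beta\phi_\alpha+\eta_\alpha\otimes\xi_\beta$, $\xi_\gamma=\phi_\alpha\xi_\beta=-\phi_\beta\xi_\alpha$, $\eta_\gamma=\eta_\alpha\circ\phi_\beta=-\eta_\beta\circ\phi_\alpha$. It is known that there is a constant $c\in\mathbb{R}$ with $[\xi_\alpha,\xi_\beta]=c\,\xi_\gamma$ for every even permutation; that $\eta_1,\eta_2,\eta_3$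 have the same rank (the rank of $M$); and that the rank is either $1$ (exactly when $c=0$) or $4l+3$ for some $l\le n$. Let $\mathcal{H}=\bigcap_{\alpha}\ker\eta_\alpha$. For rank $4l+3$, with $m=n-l$, put $\mathcal{E}^{4m}=\{X\in\mathcal{H} : i_Xd\eta_\alpha=0 \text{ for } \alpha=1,2,3\}$ and $\mathcal{E}^{4l+3}=(\mathcal{E}^{4m})^\perp$. Define the $(1,1)$-tensor $\psi_\alpha$ by $\psi_\alpha=\phi_\alpha$ on $\mathcal{E}^{4l+3}$ and $\psi_\alpha=0$ on $\mathcal{E}^{4m}$, and put $\Psi_\alpha(X,Y)=g(X,\psi_\alpha Y)$. $\nabla$ is the Levi-Civita connection of $g$ and $R_{XY}=\nabla_X\nabla_Y-\nabla_Y\nabla_X-\nabla_{[X,Y]}$. The expression $R_{XY}\phi_\alpha Z$ means $R_{XY}(\phi_\alpha Z)$. *)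

(* Defs.v *)
From HB Require Import structures.
From mathcomp Require Import all_boot all_order all_algebra perm.
From mathcomp Require Import all_classical all_reals all_analysis.
From mathcomp Require Import ring.

Set Implicit Arguments.
Unset Strict Implicit.
Unset Printing Implicit Defensive.

Import Order.TTheory GRing.Theory Num.Theory.
Import numFieldNormedType.Exports.

Local Open Scope classical_set_scope.
Local Open Scope ring_scope.

Section SmoothOn.
Context {R : realType} {d : nat}.
Implicit Types (U : set 'rV[R]_d) (f g : 'rV[R]_d -> R) (k : nat).

(* Continuous partial derivatives up to order k, meant for an open U. *)
Fixpoint Ck k U f : Prop :=
  {in U, continuous f} /\
  (if k is k'.+1 then
     forall i : 'I_d,
       (forall x, U x -> derivable f x 'e_i) /\ Ck k' U (fun x => 'D_('e_i) f x)
   else True).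

Definition smooth_on U f := forall k, Ck k U f.

Lemma Ck_cont k U f : Ck k U f -> {in U, continuous f}.
Proof. by case: k => [|k] []. Qed.

Lemma CkW k U f : Ck k.+1 U f -> Ck k U f.
Proof.
elim: k f => [|k IH] f [cf df]; first by split.
split=> // i; have [di Di] := df i; split=> //; exact: IH.
Qed.

Lemma near_open U f g x : open U -> (forall y, U y -> f y = g y) -> U x ->
  \near x, f x = g x.
Proof.
by move=> oU fg Ux; near do apply: fg; exact: open_nbhs_nbhs.
Unshelve. all: by end_near. Qed.

Lemma eq_Ck k U f g : open U -> (forall x, U x -> f x = g x) ->
  Ck k U f -> Ck k U g.
Proof.
move=> oU; elim: k f g => [|k IH] f g fg Cf.
all: have cg : {in U, continuous g}.
1,3: move=> x xU; have Ux := set_mem xU;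
  rewrite /continuous_at -(fg _ Ux); apply: cvg_trans (Ck_cont Cf xU);
  exact: near_eq_cvg (near_open oU (fun y Uy => fg y Uy) Ux).
- by split.
split=> // i; case: Cf => _ /(_ i) [df Df]; split.
  move=> x Ux; apply: near_eq_derivable (df x Ux); exact: near_open oU fg Ux.
apply: IH Df => x Ux; apply: near_eq_derive; exact: near_open oU fg Ux.
Qed.

Lemma Ck_cst k U (a : R) : open U -> Ck k U (cst a).
Proof.
move=> oU; elim: k a => [|k IH] a; split=> //; try by move=> x _; exact: cst_continuous.
move=> i; split=> [x _|]; first exact: derivable_cst.
by apply: eq_Ck oU _ (IH 0) => x _; rewrite derive_cst.
Qed.

Lemma Ck_add k U f g : open U -> Ck k U f -> Ck k U g -> Ck k U (f + g).
Proof.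
move=> oU; elim: k f g => [|k IH] f g Cf Cg.
all: have cfg : {in U, continuous (f + g)}
  by move=> x xU; apply: continuousD; [exact: Ck_cont Cf _ xU|exact: Ck_cont Cg _ xU].
- by split.
split=> // i; case: Cf Cg => _ /(_ i) [df Df] [_ /(_ i) [dg Dg]]; split.
  by move=> x Ux; apply: derivableD; [exact: df|exact: dg].
apply: eq_Ck oU _ (IH _ _ Df Dg) => x Ux.
by rewrite deriveD; [|exact: df|exact: dg].
Qed.

Lemma Ck_mul k U f g : open U -> Ck k U f -> Ck k U g -> Ck k U (f * g).
Proof.
move=> oU; elim: k f g => [|k IH] f g Cf Cg.
all: have cfg : {in U, continuous (f * g)}
  by move=> x xU; apply: continuousM; [exact: Ck_cont Cf _ xU|exact: Ck_cont Cg _ xU].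
- by split.
have [Wf Wg] := (CkW Cf, CkW Cg).
split=> // i; case: Cf Cg => _ /(_ i) [df Df] [_ /(_ i) [dg Dg]]; split.
  by move=> x Ux; apply: derivableM; [exact: df|exact: dg].
apply: eq_Ck oU _ (Ck_add oU (IH _ _ Wf Dg) (IH _ _ Wg Df)) => x Ux.
by rewrite deriveM; [|exact: df|exact: dg].
Qed.

End SmoothOn.

Record chart (R : realType) (d : nat) (T : topologicalType) := Chart {
  dom : set T;
  cod : set 'rV[R]_d;
  coord : T -> 'rV[R]_d;
  param : 'rV[R]_d -> T;
  dom_open : open dom;
  cod_open : open cod;
  coord_cod : forall p, dom p -> cod (coord p);
  param_dom : forall x, cod x -> dom (param x);
  coordK : forall p, dom p -> param (coord p) = p;
  paramK : forall x, cod x -> coord (param x) = x;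
  coord_continuous : {in dom, continuous coord};
  param_continuous : {in cod, continuous param}
}.

Arguments dom_open {R d T} c : rename.
Arguments cod_open {R d T} c : rename.

Record manifold (R : realType) (d : nat) := Manifold {
  space :> topologicalType;
  atlas : set (chart R d space);
  manifold_hausdorff : hausdorff_space space;
  manifold_second_countable : @second_countable space;
  manifold_connected : connected [set: space];
  atlas_cover : forall p : space, exists2 c, atlas c & dom c p;
  atlas_smooth : forall c c', atlas c -> atlas c' -> forall j : 'I_d,
    smooth_on (cod c `&` param c @^-1` dom c')
              (fun x => coord c' (param c x) ord0 j)
}.

Section SmoothFunctions.
Context {R : realType} {d : nat} (M : manifold R d).

Definition smooth_fun (f : M -> R) :=
  forall c, atlas c -> smooth_on (cod c) (f \o param c).

Definition smooth_pred : {pred M -> R} := [pred f | `[< smooth_fun f >]].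

Record cinf := Cinf { cinf_fun :> M -> R; cinfP : cinf_fun \in smooth_pred }.

HB.instance Definition _ := [isSub for cinf_fun].
HB.instance Definition _ := [Choice of cinf by <:].

Lemma smooth_cst (a : R) : cst a \in smooth_pred.
Proof. by apply/asboolP => c _ k; exact: (Ck_cst k a (cod_open c)). Qed.

Lemma smooth_add f g :
  f \in smooth_pred -> g \in smooth_pred -> f + g \in smooth_pred.
Proof.
move=> /asboolP sf /asboolP sg; apply/asboolP => c ac k.
exact: (Ck_add (cod_open c) (sf c ac k) (sg c ac k)).
Qed.

Lemma smooth_mul f g :
  f \in smooth_pred -> g \in smooth_pred -> f * g \in smooth_pred.
Proof.
move=> /asboolP sf /asboolP sg; apply/asboolP => c ac k.
exact: (Ck_mul (cod_open c) (sf c ac k) (sg c ac k)).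
Qed.

Lemma smooth_scale (a : R) f : f \in smooth_pred -> a *: f \in smooth_pred.
Proof. by move=> sf; rewrite (_ : a *: f = cst a * f) // smooth_mul ?smooth_cst. Qed.

Lemma smooth_subring : subring_closed smooth_pred.
Proof.
split=> [|f g sf sg|f g sf sg]; first exact: smooth_cst.
- by rewrite -scaleN1r smooth_add ?smooth_scale.
- exact: smooth_mul.
Qed.

Lemma smooth_submod : submod_closed smooth_pred.
Proof.
by split=> [|a f g sf sg]; [exact: smooth_cst|rewrite smooth_add ?smooth_scale].
Qed.

HB.instance Definition _ :=
  GRing.SubChoice_isSubComPzRing.Build _ smooth_pred cinf smooth_subring.
HB.instance Definition _ :=
  GRing.SubZmodule_isSubLmodule.Build R _ smooth_pred cinf smooth_submod.

Definition constf (a : R) : cinf := a *: (1 : cinf).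

End SmoothFunctions.

Section VectorFields.
Context {R : realType} {d : nat} (M : manifold R d).
Local Notation C := (cinf M).

Lemma cinf_scalel (a : R) (f g : C) : a *: (f * g) = (a *: f) * g.
Proof. by apply: val_inj; apply/funext => x; exact: mulrA. Qed.

Lemma cinf_scaler (a : R) (f g : C) : a *: (f * g) = f * (a *: g).
Proof. by rewrite mulrC cinf_scalel mulrC. Qed.

Definition is_derivation (X : C -> C) :=
  linear X /\ forall f g, X (f * g) = X f * g + f * X g.

Definition derivation_pred : {pred C -> C} := [pred X | `[< is_derivation X >]].

(* The smooth vector fields on M, as the derivations of C^oo(M). *)
Record vfield :=
  Vfield { vfield_fun :> C -> C; vfieldP : vfield_fun \in derivation_pred }.

HB.instance Definition _ := [isSub for vfield_fun].
HB.instance Definition _ := [Choice of vfield by <:].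

Lemma derivation_zmod : zmod_closed derivation_pred.
Proof.
split=> [|X Y /asboolP [lX dX] /asboolP [lY dY]]; apply/asboolP; split.
- by move=> a f g; rewrite /GRing.zero/= scaler0 addr0.
- by move=> f g; rewrite /GRing.zero/= mul0r mulr0 addr0.
- move=> a f g.
  change (X (a *: f + g) - Y (a *: f + g) = a *: (X f - Y f) + (X g - Y g)).
  by rewrite lX lY scalerBr opprD addrACA.
- move=> f g.
  change (X (f * g) - Y (f * g) = (X f - Y f) * g + f * (X g - Y g)).
  by rewrite dX dY mulrBl mulrBr opprD addrACA.
Qed.

HB.instance Definition _ :=
  GRing.SubChoice_isSubZmodule.Build _ derivation_pred vfield derivation_zmod.

Lemma scale_derivation (u : C) (X : vfield) :
  (fun f => u * X f) \in derivation_pred.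
Proof.
case: X => X /[dup] /asboolP [lX dX] XP; apply/asboolP; split=> [a f g|f g] /=.
  by rewrite lX mulrDr cinf_scaler.
by rewrite dX mulrDr mulrA [in u * (f * _)]mulrCA.
Qed.

Definition vscale (u : C) (X : vfield) : vfield := Vfield (scale_derivation u X).

Lemma vfieldE (X Y : vfield) : (forall f, X f = Y f) -> X = Y.
Proof. by move=> XY; apply: val_inj; apply/funext. Qed.

Lemma vscaleA u v X : vscale u (vscale v X) = vscale (u * v) X.
Proof. by apply: vfieldE => f /=; rewrite mulrA. Qed.
Lemma vscale1 : left_id 1 vscale.
Proof. by move=> X; apply: vfieldE => f /=; rewrite mul1r. Qed.
Lemma vscaleDr : right_distributive vscale +%R.
Proof. by move=> u X Y; apply: vfieldE => f; exact: mulrDr. Qed.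
Lemma vscaleDl X : {morph vscale^~ X : u v / u + v}.
Proof. by move=> u v; apply: vfieldE => f; exact: mulrDl. Qed.

HB.instance Definition _ := GRing.Zmodule_isLmodule.Build C vfield
  vscaleA vscale1 vscaleDr vscaleDl.

Lemma lie_derivation (X Y : vfield) :
  (fun f => X (Y f) - Y (X f)) \in derivation_pred.
Proof.
case: X Y => X XP [Y YP]; have [/asboolP [lX dX] /asboolP [lY dY]] := (XP, YP).
have XD f g : X (f + g) = X f + X g by rewrite -[f]scale1r lX !scale1r.
have YD f g : Y (f + g) = Y f + Y g by rewrite -[f]scale1r lY !scale1r.
apply/asboolP; split=> [a f g|f g] /=.
  by rewrite lX lY lX lY scalerBr opprD addrACA.
rewrite dX dY XD YD !dX !dY; ring.
Qed.

Definition lie (X Y : vfield) : vfield := Vfield (lie_derivation X Y).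

(* X and Y take the same value at p: the tangent vector X_p is f |-> (X f)(p). *)
Definition eq_at (p : M) (X Y : vfield) := forall f : C, X f p = Y f p.

End VectorFields.

Section Tensors.
Context {R : realType} {d : nat} (M : manifold R d).
Local Notation C := (cinf M).
Local Notation V := (vfield M).

(* Tensor fields are the C^oo(M)-multilinear maps on vector fields. *)
Definition endo_field := {linear V -> V}.
Definition one_form := {scalar V}.

Record riemannian_metric := RiemannianMetric {
  inner :> V -> V -> C;
  inner_linear : forall Y, scalar (inner^~ Y);
  inner_sym : forall X Y, inner X Y = inner Y X;
  inner_gt0 : forall p X, ~ eq_at p X 0 -> 0 < inner X X p
}.

Definition d1 (eta : V -> C) (X Y : V) : C :=
  X (eta Y) - Y (eta X) - eta (lie X Y).

Definition d2 (Phi : V -> V -> C) (X Y Z : V) : C :=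
  X (Phi Y Z) - Y (Phi X Z) + Z (Phi X Y)
  - Phi (lie X Y) Z + Phi (lie X Z) Y - Phi (lie Y Z) X.

Definition form k := ('I_k -> V) -> C.

Definition form1 (a : V -> C) : form 1 := fun X => a (X ord0).
Definition form2 (w : V -> V -> C) : form 2 := fun X => w (X ord0) (X ord_max).

Definition wedge k l (a : form k) (b : form l) : form (k + l) := fun X =>
  (k`! * l`!)%N%:R^-1 *: \sum_(s : 'S_(k + l)) (-1) ^+ s *
    (a (fun i => X (s (lshift l i))) * b (fun j => X (s (rshift k j)))).

Fixpoint wedge_pow (w : form 2) p : form (p * 2) :=
  if p is p'.+1 then wedge w (@wedge_pow w p') else fun=> 1.
Arguments wedge_pow : clear implicits.

Definition nowhere_zero k (a : form k) := forall p : M, exists X, a X p != 0.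

Definition nijenhuis (phi : V -> V) (X Y : V) : V :=
  phi (phi (lie X Y)) + lie (phi X) (phi Y)
  - phi (lie (phi X) Y) - phi (lie X (phi Y)).

Definition almost_contact_metric (g : riemannian_metric)
    (phi : endo_field) (xi : V) (eta : one_form) :=
  [/\ forall X, phi (phi X) = - X + eta X *: xi,
      eta xi = 1
    & forall X Y, g (phi X) (phi Y) = g X Y - eta X * eta Y].

Definition normal (phi : endo_field) (xi : V) (eta : one_form) :=
  forall X Y, nijenhuis phi X Y + d1 eta X Y *: xi = 0.

Definition fundamental_form (g : riemannian_metric) (phi : V -> V) (X Y : V) :=
  g X (phi Y).

Definition quasi_sasakian (g : riemannian_metric)
    (phi : endo_field) (xi : V) (eta : one_form) :=
  [/\ almost_contact_metric g phi xi eta, normal phi xi eta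
    & forall X Y Z, d2 (fundamental_form g phi) X Y Z = 0].

Definition has_rank (eta : one_form) r := exists p,
  [/\ r = (2 * p + 1)%N,
      nowhere_zero (wedge (form1 eta) (wedge_pow (form2 (d1 eta)) p))
    & forall X, wedge_pow (form2 (d1 eta)) p.+1 X = 0].

Record levi_civita (g : riemannian_metric) (nabla : V -> V -> V) : Prop := {
  nabla_linearl : forall Y : V, linear (nabla^~ Y);
  nabla_add : forall X Y Z : V, nabla X (Y + Z) = nabla X Y + nabla X Z;
  nabla_leibniz : forall (X : V) (f : C) (Y : V),
    nabla X (f *: Y) = X f *: Y + f *: nabla X Y;
  nabla_torsion : forall X Y : V, nabla X Y - nabla Y X = lie X Y;
  nabla_metric : forall X Y Z : V, X (g Y Z) = g (nabla X Y) Z + g Y (nabla X Z)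
}.

Definition curvature (nabla : V -> V -> V) (X Y Z : V) : V :=
  nabla X (nabla Y Z) - nabla Y (nabla X Z) - nabla (lie X Y) Z.

End Tensors.

Section ThreeQuasiSasakian.
Context {R : realType} {d : nat} (M : manifold R d).
Local Notation V := (vfield M).
Variables (g : riemannian_metric M) (phi : 'I_3 -> endo_field M)
  (xi : 'I_3 -> V) (eta : 'I_3 -> one_form M).

(* The indices 1, 2, 3 are the elements 0, 1, 2 of 'I_3. *)
Definition even_triple (a b c : 'I_3) :=
  exists s : 'S_3, [/\ ~~ odd_perm s, a = s 0, b = s 1 & c = s 2].

Definition three_quasi_sasakian :=
  (forall a, quasi_sasakian g (phi a) (xi a) (eta a)) /\
  forall a b c, even_triple a b c ->
    [/\ forall X, phi c X = phi a (phi b X) - eta b X *: xi a,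
        forall X, phi c X = - phi b (phi a X) + eta a X *: xi b,
        xi c = phi a (xi b) /\ xi c = - phi b (xi a),
        forall X, eta c X = eta a (phi b X)
      & forall X, eta c X = - eta b (phi a X)].

(* X_p lies in the fibre at p of the distribution E^{4m}; every tangent vector *)
(* at p is the value X_p of some vector field X on M.                          *)
Definition in_E4m (p : M) (X : V) :=
  (forall a, eta a X p = 0) /\ (forall a Y, d1 (eta a) X Y p = 0).

(* X_p lies in the fibre at p of the distribution E^{4l+3}. *)
Definition in_E4l3 (p : M) (X : V) := forall Y, in_E4m p Y -> g X Y p = 0.

Definition is_psi (a : 'I_3) (psi : endo_field M) := forall p X,
  (in_E4l3 p X -> eq_at p (psi X) (phi a X)) /\ (in_E4m p X -> eq_at p (psi X) 0).

End ThreeQuasiSasakian.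

(* Main.v *)
(** Write [T_a X = nabla_X xi_a].  For each quasi-Sasakian structure [xi_a] is
Killing, [T_a] is skew and commutes with [phi_a], and normality together with
[d Phi_a = 0] forces
  [(nabla_X phi_a) Y = g (phi_a T_a X, Y) xi_a - eta_a(Y) phi_a T_a X].
Differentiating [xi_k = phi_a xi_b = - phi_b xi_a] shows that the skew tensors
[S_a = T_a + (c/2) phi_a] kill every [xi_b], have closed associated 2-forms, and
satisfy [S_k = phi_a S_b = - phi_b S_a].  Closedness gives
[nabla_(xi_b) S_a = [T_b, S_a]]; comparing the two expressions for
[nabla_(xi_a) S_k] yields [S_a T_a = 0], that is [T_a^2 = - (c/2) phi_a T_a].
The symmetric tensor [A = phi_a S_a] does not depend on [a] and commutes with the
three [phi_b]; since all the forms [g (A X, phi_b Y)] are closed, the argument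
proving uniqueness of the Obata connection shows that [A] is parallel, whence
[nabla T_a = - (c/2) nabla phi_a].
If [c <> 0] then [- (2/c) A] is the projection onto [E^4m] and [T_a = - (c/2) psi_a];
if [c = 0] then [T_a^2 = 0], so the skew tensor [T_a] vanishes.  Differentiating
the formula for [nabla phi_a] once more gives the curvature identity. *)

Require Import Defs.
From mathcomp Require Import all_boot all_order all_algebra perm.
From mathcomp Require Import all_classical all_reals all_analysis.
From mathcomp Require Import ring.

Set Implicit Arguments.
Unset Strict Implicit.
Unset Printing Implicit Defensive.

Import Order.TTheory GRing.Theory Num.Theory.

Local Open Scope ring_scope.

(* [ring] reads the ring structure off the type of the equation, which it does
   not recognise when that type is the bare carrier [cinf M]. *)
Ltac cinf_ring :=
  lazymatch goal with |- @eq ?T ?x ?y =>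
    let T' := eval hnf in T in
    lazymatch T' with cinf ?M =>
      change (@eq (GRing.ComPzRing.sort (cinf M : comPzRingType)) x y); ring
    end
  end.

(** * Calculus of smooth functions, vector fields and the metric *)

Section SmoothAlgebra.
Context {R : realType} {d : nat} (M : manifold R d).
Local Notation C := (cinf M).
Local Notation V := (vfield M).
Implicit Types (f h : C) (X Y Z W : V).

Lemma cinf_ext f h : (forall p, f p = h p) -> f = h.
Proof. by move=> fh; apply: val_inj; apply/funext. Qed.

Lemma cinf_double_eq0 f : f + f = 0 -> f = 0.
Proof.
move=> ff0; have -> : f = (2^-1 : R) *: (f + f); last by rewrite ff0 scaler0.
by rewrite scalerDr -scalerDl [X in X *: _](_ : _ = 1) ?scale1r //; field.
Qed.

Lemma cinf_sqr_eq0 f : f * f = 0 -> f = 0.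
Proof.
move=> ff0; apply: cinf_ext => p.
have /eqP : f p * f p = 0 by have := congr1 (fun h : C => h p) ff0.
by rewrite mulf_eq0 orbb => /eqP.
Qed.

Lemma constfD (a b : R) : constf M (a + b) = constf M a + constf M b.
Proof. exact: scalerDl. Qed.

Lemma constfM (a b : R) : constf M (a * b) = constf M a * constf M b.
Proof. by rewrite /constf -cinf_scalel mul1r scalerA. Qed.

Lemma constf1 : constf M 1 = 1.
Proof. exact: scale1r. Qed.

Lemma vfield_derivation X : is_derivation X.
Proof. by apply/asboolP; exact: vfieldP. Qed.

Lemma vfieldD X f h : X (f + h) = X f + X h.
Proof.
have [lX _] := vfield_derivation X.
by rewrite -[f in LHS]scale1r lX scale1r.
Qed.

Lemma vfield0 X : X 0 = 0.
Proof. by apply: (@addIr _ (X 0)); rewrite -vfieldD !add0r. Qed.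

Lemma vfieldN X f : X (- f) = - X f.
Proof. by apply: (@addIr _ (X f)); rewrite -vfieldD !addNr vfield0. Qed.

Lemma vfieldB X f h : X (f - h) = X f - X h.
Proof. by rewrite vfieldD vfieldN. Qed.

Lemma vfieldM X f h : X (f * h) = X f * h + f * X h.
Proof. by have [_ ->] := vfield_derivation X. Qed.

Lemma vfield1 X : X 1 = 0.
Proof.
by have := vfieldM X 1 1; rewrite !mulr1 mul1r -{1}[X 1]addr0 => /addrI.
Qed.

Lemma vfield_const X (a : R) : X (constf M a) = 0.
Proof.
have [lX _] := vfield_derivation X.
by have := lX a 1 0; rewrite vfield1 vfield0 scaler0 !addr0.
Qed.

Lemma vfield_addE X Y f : (X + Y) f = X f + Y f.
Proof. by []. Qed.

Lemma vfield_oppE X f : (- X) f = - X f.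
Proof. by []. Qed.

Lemma lieE X Y f : lie X Y f = X (Y f) - Y (X f).
Proof. by []. Qed.

Lemma lieC X Y : lie X Y = - lie Y X.
Proof. by apply: vfieldE => f; rewrite vfield_oppE !lieE opprB. Qed.

Lemma jacobi X Y Z : lie (lie X Y) Z - lie (lie X Z) Y + lie (lie Y Z) X = 0.
Proof.
apply: vfieldE => f; rewrite !vfield_addE vfield_oppE !lieE !vfieldB.
rewrite [RHS](_ : _ = 0) //; cinf_ring.
Qed.

(** The second-order terms cancel identically; what remains is [eta] applied to the Jacobi
    identity. *)
Lemma d2_d1 (eta : one_form M) X Y Z : d2 (d1 eta) X Y Z = 0.
Proof.
have := congr1 eta (jacobi X Y Z).
rewrite linearD linearB linear0 /= => /eqP; rewrite addr_eq0 => /eqP jac.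
rewrite /d2 /d1 !vfieldB !lieE.
set A := eta (lie (lie X Y) Z) in jac *; set B := eta (lie (lie X Z) Y) in jac *.
set D := eta (lie (lie Y Z) X) in jac *.
have -> : A = B - D by rewrite -[A](subrK B) jac addrC.
cinf_ring.
Qed.

Section Metric.
Variable g : riemannian_metric M.

Lemma innerDl X Y Z : g (X + Y) Z = g X Z + g Y Z.
Proof.
by have := @inner_linear _ _ _ g Z 1 X Y; rewrite scale1r mul1r.
Qed.

Lemma inner0l Z : g 0 Z = 0.
Proof. by apply: (@addIr _ (g 0 Z)); rewrite -innerDl !add0r. Qed.

Lemma innerZl f X Z : g (f *: X) Z = f * g X Z.
Proof.
by have := @inner_linear _ _ _ g Z f X 0; rewrite inner0l !addr0.
Qed.

Lemma innerNl X Z : g (- X) Z = - g X Z.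
Proof. by rewrite -scaleN1r innerZl mulN1r. Qed.

Lemma innerDr X Y Z : g Z (X + Y) = g Z X + g Z Y.
Proof. by rewrite inner_sym innerDl !(inner_sym g Z). Qed.

Lemma inner0r Z : g Z 0 = 0.
Proof. by rewrite inner_sym inner0l. Qed.

Lemma innerZr f X Z : g Z (f *: X) = f * g Z X.
Proof. by rewrite inner_sym innerZl inner_sym. Qed.

Lemma innerNr X Z : g Z (- X) = - g Z X.
Proof. by rewrite inner_sym innerNl inner_sym. Qed.

Definition innerE := (innerDl, innerDr, innerNl, innerNr, innerZl, innerZr,
                      inner0l, inner0r).

Lemma inner_eq0 X : g X X = 0 -> X = 0.
Proof.
move=> gX0; apply: vfieldE => f; apply: cinf_ext => p.
have [Xp0|nX] := pselect (eq_at p X 0); first by rewrite Xp0.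
by have := inner_gt0 g nX; rewrite gX0 ltxx.
Qed.

(** Turns an equation between vector fields into one between functions, where ring normalisation
    applies; most vector identities below are proved this way. *)
Lemma inner_inj X Y : (forall W, g X W = g Y W) -> X = Y.
Proof.
move=> XY; apply: subr0_eq; apply: inner_eq0.
by rewrite innerDl innerNl XY subrr.
Qed.

(** Stated for bare functions: having an adjoint already forces linearity over the smooth functions,
    and [defect] below obtains its linearity in this way. *)
Definition adjoint_pair (T T' : V -> V) := forall X Y, g (T X) Y = g X (T' Y).
Definition skew_adjoint (T : V -> V) := adjoint_pair T (fun X => - T X).

Section Adjoint.
Variables (T T' : V -> V) (TT' : adjoint_pair T T').

Lemma adjointD X Y : T (X + Y) = T X + T Y.
Proof. by apply: inner_inj => W; rewrite !(innerDl, TT'). Qed.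

Lemma adjointZ f X : T (f *: X) = f *: T X.
Proof. by apply: inner_inj => W; rewrite innerZl !TT' innerZl. Qed.

Lemma adjointN X : T (- X) = - T X.
Proof. by apply: inner_inj => W; rewrite innerNl !TT' innerNl. Qed.

End Adjoint.

Lemma skewE (T : V -> V) : skew_adjoint T -> forall X Y, g (T X) Y = - g X (T Y).
Proof. by move=> sT X Y; rewrite sT innerNr. Qed.

End Metric.

End SmoothAlgebra.

(* Closes [a = b] from [e : x = y] when [a - b = x - y] is a ring identity. *)
Ltac cinf_from e :=
  let H := fresh in
  have H := e;
  apply: subr0_eq;
  lazymatch type of H with ?x = ?y =>
    transitivity (x - y); [cinf_ring | by apply/eqP; rewrite subr_eq0 H]
  end.

(** * Levi-Civita calculus of endomorphism fields *)

Section Connection.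
Context {R : realType} {d : nat} (M : manifold R d).
Local Notation C := (cinf M).
Local Notation V := (vfield M).
Implicit Types (f h : C) (X Y Z W : V).

Lemma endoD (phi : endo_field M) X Y : phi (X + Y) = phi X + phi Y.
Proof. exact: linearD. Qed.
Lemma endoN (phi : endo_field M) X : phi (- X) = - phi X.
Proof. exact: linearN. Qed.
Lemma endoZ (phi : endo_field M) f X : phi (f *: X) = f *: phi X.
Proof. exact: linearZ. Qed.
Lemma endo0 (phi : endo_field M) : phi 0 = 0.
Proof. exact: linear0. Qed.
Definition endoE := (endoD, endoN, endoZ, endo0).

Lemma oneformD (eta : one_form M) X Y : eta (X + Y) = eta X + eta Y.
Proof. exact: linearD. Qed.
Lemma oneformN (eta : one_form M) X : eta (- X) = - eta X.
Proof. exact: linearN. Qed.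
Lemma oneformZ (eta : one_form M) f X : eta (f *: X) = f * eta X.
Proof. exact: linearZ. Qed.
Lemma oneform0 (eta : one_form M) : eta 0 = 0.
Proof. exact: linear0. Qed.
Definition oneformE := (oneformD, oneformN, oneformZ, oneform0).

Variables (g : riemannian_metric M) (nabla : V -> V -> V).
Hypothesis hnabla : levi_civita g nabla.

Lemma nablaDl X Y Z : nabla (X + Y) Z = nabla X Z + nabla Y Z.
Proof. by have := nabla_linearl hnabla Z 1 X Y; rewrite !scale1r. Qed.

Lemma nabla0l Z : nabla 0 Z = 0.
Proof. by apply: (@addIr _ (nabla 0 Z)); rewrite -nablaDl !add0r. Qed.

Lemma nablaZl f X Z : nabla (f *: X) Z = f *: nabla X Z.
Proof. by have := nabla_linearl hnabla Z f X 0; rewrite nabla0l !addr0. Qed.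

Lemma nablaNl X Z : nabla (- X) Z = - nabla X Z.
Proof. by apply: (@addIr _ (nabla X Z)); rewrite -nablaDl !addNr nabla0l. Qed.

Lemma nablaDr X Y Z : nabla Z (X + Y) = nabla Z X + nabla Z Y.
Proof. exact: (nabla_add hnabla). Qed.

Lemma nabla0r Z : nabla Z 0 = 0.
Proof. by apply: (@addIr _ (nabla Z 0)); rewrite -nablaDr !add0r. Qed.

Lemma nablaNr X Z : nabla Z (- X) = - nabla Z X.
Proof. by apply: (@addIr _ (nabla Z X)); rewrite -nablaDr !addNr nabla0r. Qed.

Lemma nablaZr f X Z : nabla Z (f *: X) = Z f *: X + f *: nabla Z X.
Proof. exact: (nabla_leibniz hnabla). Qed.

Definition nablaE := (nablaDl, nablaDr, nablaNl, nablaNr, nablaZl, nablaZr,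
                      nabla0l, nabla0r).

Lemma lie_nabla X Y : lie X Y = nabla X Y - nabla Y X.
Proof. by rewrite (nabla_torsion hnabla). Qed.

Lemma nabla_inner X Y Z : X (g Y Z) = g (nabla X Y) Z + g Y (nabla X Z).
Proof. exact: (nabla_metric hnabla). Qed.

(** The covariant derivative $(\nabla_X T)Y$. *)
Definition cov (T : V -> V) X Y := nabla X (T Y) - T (nabla X Y).

Lemma nabla_cov (T : V -> V) X Y : nabla X (T Y) = cov T X Y + T (nabla X Y).
Proof. by rewrite subrK. Qed.

Lemma cov_ext (T T' : V -> V) X Y :
  (forall Z, T Z = T' Z) -> cov T X Y = cov T' X Y.
Proof. by move=> TT'; rewrite /cov !TT'. Qed.

Lemma cov_adjoint (T T' : V -> V) : adjoint_pair g T T' ->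
  forall X, adjoint_pair g (cov T X) (cov T' X).
Proof.
move=> TT' X Y Z; have := congr1 X (TT' Y Z).
rewrite !nabla_inner /cov !innerE -!TT' !(inner_sym _ (T _)) => e.
by cinf_from e.
Qed.

Lemma covN (T : V -> V) X Y : cov (fun X => - T X) X Y = - cov T X Y.
Proof. by rewrite /cov nablaNr opprB opprK addrC. Qed.

Lemma cov_skew (T : V -> V) : skew_adjoint g T -> forall X, skew_adjoint g (cov T X).
Proof.
move=> sT X Y Z; have -> := @cov_adjoint T (fun X => - T X) sT X Y Z.
by rewrite covN.
Qed.

Lemma cov_comp (T S : V -> V) X Y : (forall X Y, T (X + Y) = T X + T Y) ->
  cov (fun X => T (S X)) X Y = cov T X (S Y) + T (cov S X Y).
Proof.
by move=> TD; rewrite [cov (fun _ => _)]/cov !nabla_cov TD addrA addrK.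
Qed.

Lemma cov_addZ (T S : V -> V) (a : R) X Y :
  cov (fun X => T X + constf M a *: S X) X Y =
  cov T X Y + constf M a *: cov S X Y.
Proof.
apply: (@inner_inj _ _ _ g) => W.
rewrite /cov !nablaE vfield_const !innerE; cinf_ring.
Qed.

(** For a torsion-free connection the exterior derivative is the cyclic sum of covariant
    derivatives; the sign comes from [T] standing in the second slot of the form. *)
Lemma d2_skew (T : V -> V) : skew_adjoint g T -> forall X Y Z,
  d2 (fundamental_form g T) X Y Z =
  - (g (cov T X Y) Z + g (cov T Y Z) X + g (cov T Z X) Y).
Proof.
move=> sT X Y Z; rewrite (inner_sym g _ X).
rewrite (skewE (cov_skew sT X)) (skewE (cov_skew sT Z)) /d2 /fundamental_form.
rewrite !lie_nabla !nabla_inner /cov.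
rewrite !innerE.
have sT' U W A : g U (T (nabla W A)) = - g (nabla W A) (T U).
  by rewrite (inner_sym g U) (skewE sT).
rewrite !sT'.
cinf_ring.
Qed.


End Connection.

(** * Algebra of a single almost contact metric structure *)

Section AlmostContact.
Context {R : realType} {d : nat} (M : manifold R d).
Local Notation C := (cinf M).
Local Notation V := (vfield M).
Implicit Types (f h : C) (X Y Z W : V).
Variables (g : riemannian_metric M) (phi : endo_field M) (xi : V)
  (eta : one_form M).
Hypothesis hphi : almost_contact_metric g phi xi eta.

Lemma phi_phi X : phi (phi X) = - X + eta X *: xi.
Proof. by case: hphi. Qed.

Lemma eta_xi : eta xi = 1.
Proof. by case: hphi. Qed.

(** Since [phi (phi xi) = 0], applying [phi_phi] to [phi xi] gives [phi xi = f *: xi] with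
    [f = eta (phi xi)]; then [f * f = 0], so [f = 0]. *)
Lemma phi_xi : phi xi = 0.
Proof.
have pp0 : phi (phi xi) = 0 by rewrite phi_phi eta_xi scale1r addNr.
have e : phi xi = eta (phi xi) *: xi.
  by have := phi_phi (phi xi); rewrite pp0 endo0 addrC => /esym/subr0_eq.
suff e0 : eta (phi xi) = 0 by rewrite e e0 scale0r.
apply: cinf_sqr_eq0; have := congr1 eta pp0.
by rewrite {1}e endoZ oneformZ oneform0.
Qed.

Lemma eta_phi X : eta (phi X) = 0.
Proof.
have := phi_phi (phi X); rewrite {1}(phi_phi X) !endoE phi_xi scaler0 addr0.
rewrite -{1}[- phi X]addr0 => /addrI/esym/(congr1 eta).
by rewrite oneformZ oneform0 eta_xi mulr1.
Qed.

Lemma inner_phi X Y : g (phi X) (phi Y) = g X Y - eta X * eta Y.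
Proof. by case: hphi. Qed.

Lemma inner_xi X : g X xi = eta X.
Proof.
have := inner_phi X xi; rewrite phi_xi inner0r eta_xi mulr1.
by move/esym/subr0_eq.
Qed.

Lemma phi_eta_eq0 X : phi X = 0 -> eta X = 0 -> X = 0.
Proof.
move=> pX eX; apply: (@inner_eq0 _ _ _ g).
by have := inner_phi X X; rewrite pX eX mulr0 subr0 inner0l.
Qed.

Lemma phi_skew : skew_adjoint g phi.
Proof.
move=> X Y; have := inner_phi X (phi Y).
rewrite eta_phi mulr0 subr0 phi_phi !innerE inner_xi eta_phi mulr0 addr0.
by move=> <-; rewrite opprK.
Qed.

Lemma phi_phi_phi X : phi (phi (phi X)) = - phi X.
Proof. by rewrite phi_phi eta_phi scale0r addr0. Qed.

End AlmostContact.

(** * Covariant derivatives of [xi] and [phi] on a quasi-Sasakian manifold *)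

Section QuasiSasakian.
Context {R : realType} {d : nat} (M : manifold R d).
Local Notation C := (cinf M).
Local Notation V := (vfield M).
Implicit Types (f h : C) (X Y Z W : V).
Variables (g : riemannian_metric M) (nabla : V -> V -> V).
Hypothesis hnabla : levi_civita g nabla.
Variables (phi : endo_field M) (xi : V) (eta : one_form M).
Hypothesis hphi : quasi_sasakian g phi xi eta.

Let acm : almost_contact_metric g phi xi eta. Proof. by case: hphi. Qed.

Local Notation T := (fun X => nabla X xi).

Lemma eta_nijenhuis X Y : eta (lie (phi X) (phi Y)) + d1 eta X Y = 0.
Proof.
have [_ /(_ X Y)/(congr1 eta) + _] := hphi.
rewrite /nijenhuis !(oneformE, eta_phi acm) (eta_xi acm) mulr1 => e.
by cinf_from e.
Qed.

Lemma d1_xi X : d1 eta X xi = 0.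
Proof.
have := eta_nijenhuis X xi; rewrite (phi_xi acm).
have -> : lie (phi X) 0 = 0.
  by apply: vfieldE => f; rewrite lieE vfield0 subr0.
by rewrite oneform0 add0r.
Qed.

Lemma eta_lie_xi X : eta (lie xi X) = xi (eta X).
Proof.
have := d1_xi X; rewrite /d1 (eta_xi acm) vfield1 lieC oneformN => e.
by cinf_from e.
Qed.

(** Normality with second argument [xi] says that [phi] kills the difference of the two sides; [eta]
    kills it as well, so it vanishes. *)
Lemma lie_xi_phi X : lie xi (phi X) = phi (lie xi X).
Proof.
have [_ /(_ X xi) + _] := hphi; rewrite d1_xi scale0r addr0.
rewrite /nijenhuis (phi_xi acm).
have lie0 Y : lie Y 0 = 0.
  by apply: vfieldE => f; rewrite lieE vfield0 subr0.
rewrite !lie0 endo0 addr0 subr0 -endoN -endoD => e.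
have /subr0_eq : phi (lie X xi) - lie (phi X) xi = 0.
  apply: (phi_eta_eq0 acm) => //.
  rewrite oneformD oneformN (eta_phi acm) (lieC (phi X)) oneformN eta_lie_xi.
  by rewrite (eta_phi acm) vfield0 !oppr0 addr0.
by rewrite (lieC X) (lieC (phi X)) endoN => /oppr_inj.
Qed.

(** As [xi] contracts the fundamental form to zero, closedness makes that form invariant under [xi].
    Since [phi] is invariant too, replacing [Z] by [phi Z] recovers the invariance of [g]. *)
Lemma killing Y Z : xi (g Y Z) = g (lie xi Y) Z + g Y (lie xi Z).
Proof.
have dPhi U W : xi (g U (phi W)) = g (lie xi U) (phi W) + g U (phi (lie xi W)).
  have [_ _ /(_ xi U W)] := hphi; rewrite /d2 /fundamental_form.
  have g0 A : g xi (phi A) = 0 by rewrite inner_sym (inner_xi acm) (eta_phi acm).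
  rewrite !g0 !vfield0 (phi_xi acm) inner0r => e.
  rewrite -[g U (phi (lie xi W))]opprK -innerNr -(phi_skew acm).
  rewrite (inner_sym _ _ (lie xi W)).
  by cinf_from e.
have := dPhi Y (phi Z); rewrite lie_xi_phi !(phi_phi acm) !innerE !(inner_xi acm).
rewrite vfieldD vfieldN vfieldM !eta_lie_xi => e.
by cinf_from (esym e).
Qed.

Lemma T_skew : skew_adjoint g T.
Proof.
move=> Y Z; have := killing Y Z.
rewrite !(lie_nabla hnabla) (nabla_inner hnabla) !innerE => e.
by cinf_from e.
Qed.

Lemma eta_T X : eta (T X) = 0.
Proof.
apply: cinf_double_eq0; have := nabla_inner hnabla X xi xi.
by rewrite (inner_sym g xi) !(inner_xi acm) (eta_xi acm) vfield1 => <-.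
Qed.

Lemma T_xi : T xi = 0.
Proof.
apply: (@inner_inj _ _ _ g) => W.
by rewrite (skewE T_skew) inner_sym (inner_xi acm) eta_T oppr0 inner0l.
Qed.

Lemma d1_T X Y : d1 eta X Y = g (T X) Y + g (T X) Y.
Proof.
rewrite {2}(skewE T_skew) /d1 -!(inner_xi acm) !(nabla_inner hnabla).
rewrite (lie_nabla hnabla) !innerE !(inner_sym g (nabla _ xi)); cinf_ring.
Qed.

(** Because [eta] vanishes on the image of [phi], the [eta]-component of normality says that
    [d1 eta] is [phi]-invariant, and [d1 eta] is twice [g (T X) Y]. *)
Lemma inner_T_phi X Y : g (T (phi X)) (phi Y) = g (T X) Y.
Proof.
apply: subr0_eq; apply: cinf_double_eq0; have := eta_nijenhuis X Y.
have := d1_T (phi X) (phi Y); rewrite {1}/d1 !(eta_phi acm) !vfield0 d1_T => e1 e2.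
have e := congr2 +%R e1 e2; by cinf_from (esym e).
Qed.

Lemma T_phi X : T (phi X) = phi (T X).
Proof.
apply: (@inner_inj _ _ _ g) => W; rewrite (skewE (phi_skew acm)).
rewrite -(inner_T_phi X) (phi_phi acm) !innerE (inner_xi acm) eta_T.
cinf_ring.
Qed.

Lemma cov_phi_at_xi Y : cov nabla phi xi Y = 0.
Proof.
have := lie_xi_phi Y; rewrite !(lie_nabla hnabla) T_phi endoD endoN => /addIr.
by rewrite /cov => ->; rewrite subrr.
Qed.

Lemma inner_nijenhuis X Y W :
  g (cov nabla phi (phi X) Y) W - g (cov nabla phi (phi Y) X) W
  + g (cov nabla phi X Y) (phi W) - g (cov nabla phi Y X) (phi W)
  + (g (T X) Y + g (T X) Y) * eta W = 0.
Proof.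
have [_ /(_ X Y)/(congr1 (g^~ W)) + _] := hphi; rewrite inner0l => e.
rewrite -(inner_xi acm) (inner_sym g W) -d1_T.
move: e; rewrite /nijenhuis !(lie_nabla hnabla) !(nabla_cov nabla phi).
rewrite !(innerE, endoE) !(skewE (phi_skew acm)) => e.
by cinf_from e.
Qed.

Lemma phi_cyc X Y Z : g (cov nabla phi X Y) Z + g (cov nabla phi Y Z) X
  + g (cov nabla phi Z X) Y = 0.
Proof.
have [_ _ /(_ X Y Z)] := hphi; rewrite (d2_skew hnabla (phi_skew acm)) => /eqP.
by rewrite oppr_eq0 => /eqP.
Qed.

Lemma cov_phi X Y :
  cov nabla phi X Y = g (phi (T X)) Y *: xi - eta Y *: phi (T X).
Proof.
set G := fun X Y Z => g (cov nabla phi X Y) Z.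
have Gskew U Y' Z' : G U Y' Z' = - G U Z' Y'.
  by rewrite /G (skewE (cov_skew hnabla (phi_skew acm) _)) inner_sym.
have Gcyc U Y' Z' : G U Y' Z' + G Y' Z' U + G Z' U Y' = 0 by exact: phi_cyc.
(* Two instances of normality minus two cyclic identities leave twice the claim: the other values of
   [G] cancel by skewness in the last two arguments. *)
have H Z' W U : G (phi Z') W U = g (T Z') U * eta W - g (T Z') W * eta U.
  have e1 := inner_nijenhuis U Z' W; have e2 := inner_nijenhuis Z' W U.
  have c1 := Gcyc (phi W) U Z'; have c2 := Gcyc (phi U) Z' W.
  rewrite -!/(G _ _ _) in e1 e2.
  rewrite (Gskew (phi Z') U) in e1.
  rewrite (Gskew Z' (phi W)) (Gskew (phi W)) in c1; rewrite (Gskew W (phi U)) in c2.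
  have TU : g (T U) Z' = - g (T Z') U by rewrite (skewE T_skew) inner_sym.
  rewrite TU in e1.
  have e := congr2 (fun a b => a - b) (congr2 +%R e1 e2) (congr2 +%R c1 c2).
  apply: subr0_eq; apply: cinf_double_eq0; cinf_from e.
(* [H] only covers derivatives in directions [phi Z']; the remaining [xi]-direction contributes
   nothing by [cov_phi_at_xi]. *)
have XE : X = - phi (phi X) + eta X *: xi.
  by rewrite (phi_phi acm) opprD opprK subrK.
have covX A h : cov nabla phi (- A + h *: xi) Y = - cov nabla phi A Y.
  apply: (@inner_inj _ _ _ g) => W.
  have := congr1 (g^~ W) (cov_phi_at_xi Y); rewrite /cov.
  rewrite !(nablaDl hnabla, nablaNl hnabla, nablaZl hnabla) !(endoE, innerE) => e.
  by cinf_from (congr1 (fun a => h * a) e).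
apply: (@inner_inj _ _ _ g) => W.
rewrite [in LHS]XE covX innerNl [g (cov _ _ _ _) _]H !T_phi !innerE.
by rewrite (inner_sym g xi) (inner_xi acm); cinf_ring.
Qed.

(** The 2-form of [T] is half of [d1 eta], hence closed by [d2_d1]. *)
Lemma T_cyc X Y Z : g (cov nabla T X Y) Z + g (cov nabla T Y Z) X
  + g (cov nabla T Z X) Y = 0.
Proof.
have := d2_d1 eta X Y Z; rewrite /d2 !d1_T !vfieldD => e1.
have := d2_skew hnabla T_skew X Y Z; rewrite /d2 /fundamental_form => e2.
have Tr U W : g U (nabla W xi) = - g (T U) W by rewrite (skewE T_skew) opprK.
rewrite !Tr !vfieldN in e2.
apply: cinf_double_eq0; have e := congr2 (fun a b => a + (b + b)) e1 e2.
by cinf_from e.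
Qed.

End QuasiSasakian.

(** * Even triples of indices *)

Lemma even_triple_rot a b k : even_triple a b k -> even_triple b k a.
Proof.
case=> s [evs -> -> ->].
(* The left factor of a product acts first, so the two transpositions compose to the even cycle 0 ->
   1 -> 2 -> 0. *)
exists (tperm (0%R : 'I_3) 1%R * tperm 0%R 2%R * s)%g; split.
- by rewrite !odd_permM !odd_tperm.
- by rewrite !permM tpermL tpermD.
- by rewrite !permM tpermR tpermL.
- by rewrite !permM (@tpermD _ (0 : 'I_3) 1 2) // tpermR.
Qed.

Lemma even_triple012 : even_triple 0 1 2.
Proof. by exists 1%g; rewrite odd_perm1 !perm1. Qed.

Lemma ord3_ind (P : 'I_3 -> Prop) : P 0 -> P 1 -> P 2 -> forall a, P a.
Proof.
move=> P0 P1 P2 [[|[|[|//]]] lt_a].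
- by rewrite [Ordinal _](_ : _ = 0); last exact: val_inj.
- by rewrite [Ordinal _](_ : _ = 1); last exact: val_inj.
- by rewrite [Ordinal _](_ : _ = 2); last exact: val_inj.
Qed.

Lemma even_triple_ex a : exists b k, even_triple a b k.
Proof.
have e012 := even_triple012; have e120 := even_triple_rot e012.
have e201 := even_triple_rot e120.
by elim/ord3_ind: a; do 2 eexists; [exact: e012|exact: e120|exact: e201].
Qed.

(** Two distinct indices, in one order or the other, are the first two entries of an even triple. *)
Lemma even_triple_ind (P : 'I_3 -> 'I_3 -> Prop) : (forall a, P a a) ->
  (forall a b k, even_triple a b k -> P a b /\ P b a) -> forall a b, P a b.
Proof.
move=> Paa Pab.
have e012 := even_triple012; have e120 := even_triple_rot e012.
have e201 := even_triple_rot e120.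
have [P01 P10] := Pab _ _ _ e012.
have [P12 P21] := Pab _ _ _ e120.
have [P20 P02] := Pab _ _ _ e201.
by elim/ord3_ind; elim/ord3_ind.
Qed.

(** * Vanishing of symmetric forms compatible with a hypercomplex structure *)

Section Obata.
Context {A : Type} {C : comPzRingType}.
Variables (al : A -> A -> A -> C) (I J K : A -> A).
Hypothesis double_eq0 : forall f : C, f + f = 0 -> f = 0.
Hypothesis al_sym : forall X Y Z, al X Y Z = al X Z Y.

(** Everything is tested through [al], because the [phi a] satisfy the quaternionic relations only
    up to multiples of the fields [xi], which [al] will not see. *)
Definition compatible (phi : A -> A) :=
  [/\ forall X Y Z, al X (phi Y) Z = - al X Y (phi Z),
      forall X Y Z, al X (phi (phi Y)) Z = - al X Y Z
    & forall X Y Z, al X (phi Y) Z + al Y (phi Z) X + al Z (phi X) Y = 0].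

Lemma compatible_antisym phi : compatible phi -> forall X Y Z,
  al (phi Y) (phi Z) X = al X Y Z - al Z X Y.
Proof.
case=> phi_anti phi_sqr phi_cyc X Y Z; have := phi_cyc X (phi Y) Z.
have -> : al Z (phi X) (phi Y) = al Z X Y.
  by rewrite phi_anti al_sym phi_sqr opprK al_sym.
rewrite phi_sqr -addrA => /eqP; rewrite addrC subr_eq0 => /eqP <-.
by rewrite addrK.
Qed.

Hypotheses (cI : compatible I) (cJ : compatible J) (cK : compatible K).
Hypothesis IJ1 : forall X Y Z, al (I (J X)) Y Z = al (K X) Y Z.
Hypothesis IJ2 : forall X Y Z, al X (I (J Y)) Z = al X (K Y) Z.

(* Uniqueness of the Obata connection: a hypercomplex structure admits only one
   torsion-free connection, so a symmetric form that is Hermitian for it and has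
   closed Kaehler forms is parallel. *)
Lemma obata_unique X Y Z : al X Y Z = 0.
Proof.
(* [al (K Y') (K Z') U] is computed twice: by [compatible_antisym] for [K], and with [K] replaced by
   the composite of [I] and [J]. *)
have split U Y' Z' : al U Y' Z' = al Y' U Z' + al Z' U Y'.
  have := compatible_antisym cK U Y' Z'.
  have [anti sqr _] := cJ.
  have eJ : al U (J Y') (J Z') = al U Y' Z' by rewrite anti al_sym sqr opprK al_sym.
  have eJ' : al (J Z') U (J Y') = al U Z' Y' - al Y' U Z'.
    by rewrite al_sym (compatible_antisym cJ).
  rewrite -IJ1 -IJ2 (compatible_antisym cI) eJ eJ' (al_sym U Z').
  by move/addrI/oppr_inj => <-; rewrite addrC subrK.
(* Writing x, y, z for the values with [X], [Y], [Z] in the first slot, [e1] is y = z + x and [e2]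
   is z = x + y, so 2x = 0. *)
apply: double_eq0; have e1 := split Y Z X; have e2 := split Z X Y.
move: e1; rewrite (al_sym Z) e2 (al_sym Y) (al_sym X Z) -addrA.
by rewrite -{1}[al Y _ _]addr0 addrCA => /addrI.
Qed.

End Obata.

(** * Covariant derivatives of the three fields [xi a] *)

Section ThreeQuasiSasakian.
Context {R : realType} {d : nat} (M : manifold R d).
Local Notation C := (cinf M).
Local Notation V := (vfield M).
Implicit Types (X Y Z W : V) (a b k : 'I_3).
Variables (g : riemannian_metric M) (nabla : V -> V -> V).
Hypothesis hnabla : levi_civita g nabla.
Variables (phi : 'I_3 -> endo_field M) (xi : 'I_3 -> V)
  (eta : 'I_3 -> one_form M).
Hypothesis hM : three_quasi_sasakian g phi xi eta.
Variable c : R.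
Hypothesis hc : forall a b k, even_triple a b k ->
  lie (xi a) (xi b) = constf M c *: xi k.

Let qs a : quasi_sasakian g (phi a) (xi a) (eta a). Proof. by case: hM. Qed.
Let acm a : almost_contact_metric g (phi a) (xi a) (eta a).
Proof. by case: (qs a). Qed.

Local Notation T a X := (nabla X (xi a)).
Local Notation h := (constf M (c / 2)).

Lemma constf_half : constf M c = h + h.
Proof. by rewrite -constfD; congr constf; field. Qed.

Lemma eta_xi_even a b k : even_triple a b k ->
  eta a (xi k) = 0 /\ eta b (xi k) = 0.
Proof.
move=> ev; have [_ /(_ _ _ _ ev) [_ _ [ek ek'] _ _]] := hM; split.
  by rewrite ek (eta_phi (acm a)).
by rewrite ek' oneformN (eta_phi (acm b)) oppr0.
Qed.

Lemma eta_xi_neq a b k : even_triple a b k ->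
  eta a (xi b) = 0 /\ eta b (xi a) = 0.
Proof.
move=> ev; have ev' := even_triple_rot ev.
by have [-> _] := eta_xi_even ev'; have [_ ->] := eta_xi_even (even_triple_rot ev').
Qed.

Lemma phi_xi_even a b k : even_triple a b k ->
  phi a (xi b) = xi k /\ phi b (xi a) = - xi k.
Proof.
move=> ev; have [_ /(_ _ _ _ ev) [_ _ [ek ek'] _ _]] := hM.
by rewrite -ek ek' opprK.
Qed.

(** Orthogonality of [xi a] and [xi b], together with skewness of both [T], makes the two
    derivatives opposite; each is therefore half of the bracket up to sign. *)
Lemma nabla_xi_even a b k : even_triple a b k ->
  T b (xi a) = h *: xi k /\ T a (xi b) = - (h *: xi k).
Proof.
move=> ev; have TN : T a (xi b) = - T b (xi a).
  apply: (@inner_inj _ _ _ g) => W; rewrite innerNl.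
  rewrite (skewE (T_skew hnabla (qs a))) (skewE (T_skew hnabla (qs b))).
  have := nabla_inner hnabla W (xi a) (xi b).
  have -> : g (xi a) (xi b) = 0.
    by rewrite (inner_xi (acm b)); have [_ ->] := eta_xi_neq ev.
  by rewrite vfield0 (inner_sym g (T a W)) => e; cinf_from e.
have e := hc ev; rewrite (lie_nabla hnabla) TN opprK in e.
suff Tba : T b (xi a) = h *: xi k by rewrite TN Tba.
apply: (@inner_inj _ _ _ g) => W.
apply: subr0_eq; apply: cinf_double_eq0; have := congr1 (g^~ W) e.
by rewrite constf_half !innerE => {}e; cinf_from e.
Qed.

Lemma nabla_xi_succ a b k X : even_triple a b k ->
  T k X = phi a (T b X) + (h * eta b X) *: xi a /\
  T k X = - phi b (T a X) - (h * eta a X) *: xi b.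
Proof.
move=> ev; have ev1 := even_triple_rot ev; have ev2 := even_triple_rot ev1.
have [_ /(_ _ _ _ ev) [_ _ [ek ek'] _ _]] := hM.
have [pab pba] := phi_xi_even ev.
have [eab eba] := eta_xi_neq ev.
have [Tak _] := nabla_xi_even ev2; have [_ Tbk] := nabla_xi_even ev1.
have Ta : g (phi a (T a X)) (xi b) = h * eta b X.
  rewrite (skewE (phi_skew (acm a))) pab (skewE (T_skew hnabla (qs a))) opprK.
  by rewrite Tak innerZr (inner_xi (acm b)).
have Tb : g (phi b (T b X)) (xi a) = h * eta a X.
  rewrite (skewE (phi_skew (acm b))) pba innerNr opprK.
  rewrite (skewE (T_skew hnabla (qs b))) Tbk innerNr opprK innerZr.
  by rewrite (inner_xi (acm a)).
split; apply: (@inner_inj _ _ _ g) => W.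
  rewrite ek (nabla_cov nabla (phi a)) (cov_phi hnabla (qs a)).
  by rewrite Ta eab !innerE; cinf_ring.
rewrite ek' (nablaNr hnabla) (nabla_cov nabla (phi b)) (cov_phi hnabla (qs b)).
by rewrite Tb eba !innerE; cinf_ring.
Qed.

(** * Algebra of the tensors S_a and their covariant derivatives *)

Definition defect a X := T a X + h *: phi a X.

Local Notation S := defect.

Lemma defect_skew a : skew_adjoint g (S a).
Proof.
move=> X Y; rewrite /S !innerE (skewE (T_skew hnabla (qs a))).
by rewrite (skewE (phi_skew (acm a))); cinf_ring.
Qed.

Lemma defectD a X Y : S a (X + Y) = S a X + S a Y.
Proof. exact: adjointD (defect_skew a) _ _. Qed.

Lemma defectZ a f X : S a (f *: X) = f *: S a X.
Proof. exact: adjointZ (defect_skew a) _ _. Qed.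

Lemma defectN a X : S a (- X) = - S a X.
Proof. exact: adjointN (defect_skew a) _. Qed.

Lemma defect_phi a X : S a (phi a X) = phi a (S a X).
Proof. by rewrite /S (T_phi hnabla (qs a)) endoD endoZ. Qed.

Lemma defect_nabla_xi a X : S a (T a X) = T a (S a X).
Proof.
by rewrite /S (nablaDl hnabla) (nablaZl hnabla) (T_phi hnabla (qs a)).
Qed.

Lemma defect_xi a b : S a (xi b) = 0.
Proof.
move: a b; apply: even_triple_ind => [a|a b k ev]; rewrite /S.
  by rewrite (T_xi hnabla (qs a)) (phi_xi (acm a)) scaler0 addr0.
have [-> ->] := nabla_xi_even ev; have [-> ->] := phi_xi_even ev.
by rewrite scalerN addNr addrN.
Qed.

Lemma eta_defect a b X : eta b (S a X) = 0.
Proof.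
by rewrite -(inner_xi (acm b)) (skewE (defect_skew a)) defect_xi inner0r oppr0.
Qed.

(** The summand [h *: phi a X] of [defect] is chosen so that the [xi]-terms of [nabla_xi_succ]
    cancel against those in the quaternionic relations. *)
Lemma defect_succ a b k X : even_triple a b k ->
  S k X = phi a (S b X) /\ S k X = - phi b (S a X).
Proof.
move=> ev; have [_ /(_ _ _ _ ev) [p1 p2 _ _ _]] := hM.
have [t1 t2] := nabla_xi_succ X ev; rewrite /S.
split; apply: (@inner_inj _ _ _ g) => W.
  by rewrite t1 p1 !(endoE, innerE); cinf_ring.
by rewrite t2 p2 !(endoE, innerE); cinf_ring.
Qed.

(** The adjoint form of [defect_succ]. *)
Lemma defect_succ_phi a b k X : even_triple a b k ->
  S k X = S a (phi b X) /\ S k X = - S b (phi a X).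
Proof.
move=> ev; split; apply: (@inner_inj _ _ _ g) => W.
  rewrite !(skewE (defect_skew _)) (skewE (phi_skew (acm b))) opprK.
  by have [_ ->] := defect_succ W ev; rewrite innerNr opprK.
rewrite innerNl !(skewE (defect_skew _)) (skewE (phi_skew (acm a))) opprK.
by have [-> _] := defect_succ W ev.
Qed.

Lemma cov_defect a X Y :
  cov nabla (S a) X Y =
  cov nabla (fun X => T a X) X Y + h *: cov nabla (phi a) X Y.
Proof. exact: (cov_addZ hnabla). Qed.

Lemma defect_cyc a X Y Z : g (cov nabla (S a) X Y) Z
  + g (cov nabla (S a) Y Z) X + g (cov nabla (S a) Z X) Y = 0.
Proof.
have e1 := T_cyc hnabla (qs a) X Y Z; have e2 := phi_cyc hnabla (qs a) X Y Z.
rewrite /cov !innerE in e1 e2; rewrite !cov_defect /cov !innerE.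
by cinf_from (congr2 (fun u v => u + h * v) e1 e2).
Qed.

Lemma cov_defect_xi a b X : cov nabla (S a) X (xi b) = - S a (T b X).
Proof. by rewrite /cov defect_xi (nabla0r hnabla) sub0r. Qed.

(** In the cyclic identity with [xi b] in one slot, the other two terms are explicit by
    [cov_defect_xi]. *)
Lemma cov_defect_at_xi a b Y :
  cov nabla (S a) (xi b) Y = T b (S a Y) - S a (T b Y).
Proof.
apply: (@inner_inj _ _ _ g) => Z; have := defect_cyc a (xi b) Y Z.
rewrite (skewE (cov_skew hnabla (defect_skew a) Y)) !cov_defect_xi.
rewrite innerNl innerNr (skewE (defect_skew a)) (skewE (T_skew hnabla (qs b))).
by rewrite !(inner_sym g Z) => e; rewrite innerDl innerNl; cinf_from e.
Qed.

Lemma defect_even_nabla_xi a b k Y : even_triple a b k ->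
  S k (T a Y) = T a (S k Y).
Proof.
move=> ev; have [_ Tba] := phi_xi_even ev; have [Tba' _] := nabla_xi_even ev.
have [pbk _] := phi_xi_even (even_triple_rot ev).
(* By [cov_phi] this derivative is a combination of [xi b] and [phi b (xi k) = xi a], both killed by
   [S a]. *)
have cov_phi0 : S a (cov nabla (phi b) (xi a) Y) = 0.
  rewrite (cov_phi hnabla (qs b)) Tba' endoZ pbk defectD defectN !defectZ.
  by rewrite !defect_xi !scaler0 oppr0 addr0.
have := cov_defect_at_xi k a Y.
rewrite (cov_ext nabla (T' := fun X => S a (phi b X))); last first.
  by move=> X; have [] := defect_succ_phi X ev.
rewrite (cov_comp nabla _ _ _ (defectD a)) cov_phi0 addr0.
by rewrite cov_defect_at_xi defect_nabla_xi subrr => /esym/subr0_eq.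
Qed.

Lemma defect_nabla_xi_eq0 a X : S a (T a X) = 0.
Proof.
have [b [k ev]] := even_triple_ex a.
have ev1 := even_triple_rot ev; have ev2 := even_triple_rot ev1.
have SE U : T a U = S a U - h *: phi a U by rewrite /S addrK.
have aSk Y : phi a (S k Y) = - S b Y.
  by have [_ ->] := defect_succ Y ev2; rewrite opprK.
(* Substituting [T a = S a - h *: phi a] into [defect_even_nabla_xi]: as [S k] and [S a]
   anticommute, the identity is twice the claim. *)
have key Y : S a (S k Y) = - (h *: S b Y).
  have := defect_even_nabla_xi Y ev; rewrite !SE defectD defectN defectZ aSk.
  have [<- _] := defect_succ_phi Y ev2.
  have [-> _] := defect_succ_phi (S a Y) ev.
  have -> : phi b (S a Y) = - S k Y.
    by have [_ ->] := defect_succ Y ev; rewrite opprK.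
  rewrite defectN => e; apply: (@inner_inj _ _ _ g) => W.
  apply: subr0_eq; apply: cinf_double_eq0; have := congr1 (g^~ W) e.
  by rewrite !innerE => {}e; cinf_from (esym e).
have SS Y : S a (S b Y) = h *: phi a (S b Y).
  have := key Y; have [-> _] := defect_succ Y ev; rewrite defect_phi.
  move/(congr1 (phi a)); rewrite (phi_phi (acm a)) eta_defect endoN endoZ.
  by rewrite (scale0r (xi a)) addr0 => /oppr_inj.
(* Since [S b Y = - S a (phi k Y)], [SS] says that S_a^2 and h phi_a S_a agree on the image of
   [phi k]. Then X is recovered from [phi k (phi k X)], the [xi k]-part being sent by [T a] to a
   multiple of [xi b]. *)
have STphi Y : S a (T a (phi k Y)) = 0.
  rewrite SE defectD defectN defectZ defect_phi.
  have := SS Y; have [_ ->] := defect_succ_phi Y ev2.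
  rewrite defectN endoN scalerN => /oppr_inj ->.
  by rewrite subrr.
have := STphi (phi k X); rewrite (phi_phi (acm k)).
rewrite (nablaDl hnabla) (nablaNl hnabla) (nablaZl hnabla).
have [-> _] := nabla_xi_even ev2.
rewrite defectD defectN !defectZ defect_xi !scaler0 addr0 => e.
by rewrite -[LHS]opprK e oppr0.
Qed.

Lemma cov_phi_defect a X Y : cov nabla (phi a) X (S a Y) = 0.
Proof.
rewrite (cov_phi hnabla (qs a)) eta_defect inner_sym (skewE (defect_skew a)).
rewrite defect_phi defect_nabla_xi_eq0 endo0 inner0r oppr0.
by rewrite (scale0r (xi a)) (scale0r (phi a _)) subrr.
Qed.

Lemma defect_cov_phi a X Y : S a (cov nabla (phi a) X Y) = 0.
Proof.
rewrite (cov_phi hnabla (qs a)) defectD defectN !defectZ defect_xi defect_phi.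
by rewrite defect_nabla_xi_eq0 (endo0 (phi a)) !scaler0 subrr.
Qed.

Lemma cov_defect_phi a X Y :
  cov nabla (S a) X (phi a Y) = phi a (cov nabla (S a) X Y).
Proof.
have := cov_comp nabla (phi a) X Y (defectD a).
rewrite defect_cov_phi addr0 => <-.
rewrite (cov_ext nabla (T' := fun X => phi a (S a X))); last exact: defect_phi.
by rewrite (cov_comp nabla _ _ _ (endoD _)) cov_phi_defect add0r.
Qed.

(* Up to the factor [- c / 2], the projection onto the distribution E^4m. *)
Definition phi_defect a X := phi a (S a X).

(** * Parallelism of [A] and of the S_a *)

Local Notation A := phi_defect.

(** Here [S b] is [phi k] after [S a], and [phi b] after [phi k] is [phi a] up to a [xi b]-term with
    coefficient [eta k (S a X) = 0]. *)
Lemma phi_defect_even a b k X : even_triple a b k -> A a X = A b X.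
Proof.
move=> ev; have ev1 := even_triple_rot ev; have ev2 := even_triple_rot ev1.
rewrite /A; have [-> _] := defect_succ X ev2.
have [_ /(_ _ _ _ ev1) [-> _ _ _ _]] := hM.
by rewrite eta_defect (scale0r (xi b)) subr0.
Qed.

Lemma phi_defect_indep a b X : A a X = A b X.
Proof.
move: a b; apply: even_triple_ind => // a b k ev.
by rewrite (phi_defect_even X ev).
Qed.

Lemma defectE a X : S a X = - phi a (A a X).
Proof. by rewrite /A (phi_phi (acm a)) eta_defect scale0r addr0 opprK. Qed.

Lemma defect_nabla_xi_eq0' a b X : S a (T b X) = 0.
Proof.
rewrite defectE (phi_defect_indep a b) /A defect_nabla_xi_eq0.
by rewrite (endo0 (phi b)) (endo0 (phi a)) oppr0.
Qed.

Lemma eta_cov_defect a b X Y : eta b (cov nabla (S a) X Y) = 0.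
Proof.
rewrite -(inner_xi (acm b)) (skewE (cov_skew hnabla (defect_skew a) X)).
by rewrite cov_defect_xi defect_nabla_xi_eq0' oppr0 inner0r oppr0.
Qed.

Lemma phi_defect_sym a : adjoint_pair g (A a) (A a).
Proof.
move=> X Y; rewrite /A (skewE (phi_skew (acm a))) (skewE (defect_skew a)) opprK.
by rewrite defect_phi.
Qed.

Lemma cov_phi_defectE a X Y :
  cov nabla (A a) X Y = phi a (cov nabla (S a) X Y).
Proof. by rewrite (cov_comp nabla _ _ _ (endoD _)) cov_phi_defect add0r. Qed.

Lemma cov_phi_defect_indep a b X Y : cov nabla (A a) X Y = cov nabla (A b) X Y.
Proof. by apply: cov_ext => Z; exact: phi_defect_indep. Qed.

(** Independence of the index allows writing [A] with index [b]; then composing with [phi b] gives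
    minus the derivative of [S b], so the cyclic condition is [defect_cyc]. *)
Lemma cov_phi_defect_compatible a b :
  compatible (fun X Y => g (cov nabla (A a) X Y)) (phi b).
Proof.
have covE U W : cov nabla (A a) U W = phi b (cov nabla (S b) U W).
  by rewrite (cov_phi_defect_indep a b) cov_phi_defectE.
split=> X Y Z; rewrite !covE !cov_defect_phi.
- by rewrite (skewE (phi_skew (acm b))).
- by rewrite (phi_phi_phi (acm b)) innerNl.
- rewrite !(phi_phi (acm b)) !eta_cov_defect !scale0r !addr0 !innerNl.
  by cinf_from (congr1 -%R (defect_cyc b X Y Z)).
Qed.

Lemma cov_phi_defect_at_xi a Y : cov nabla (A a) (xi a) Y = 0.
Proof.
rewrite cov_phi_defectE cov_defect_at_xi -defect_nabla_xi subrr.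
exact: (endo0 (phi a)).
Qed.

Lemma cov_phi_defect_eq0 a X Y : cov nabla (A a) X Y = 0.
Proof.
apply: (@inner_inj _ _ _ g) => Z; rewrite inner0l.
have [b [k ev]] := even_triple_ex a.
have [_ /(_ _ _ _ ev) [pk _ _ _ _]] := hM.
have Asym := cov_adjoint hnabla (phi_defect_sym a).
have c1 := cov_phi_defect_compatible a.
apply: (obata_unique (al := fun X Y => g (cov nabla (A a) X Y))
  (@cinf_double_eq0 _ _ _) _ (c1 a) (c1 b) (c1 k)).
- by move=> {X Y Z} X Y Z; rewrite Asym inner_sym.
(* The extra [xi a] in the direction of differentiation is harmless by [cov_phi_defect_at_xi]. *)
- move=> {X Y Z} X Y Z; rewrite pk.
  have := congr1 (g^~ Z) (cov_phi_defect_at_xi a Y).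
  rewrite /cov !(nablaDl hnabla, nablaNl hnabla, nablaZl hnabla) !innerE.
  rewrite !(adjointD (phi_defect_sym a)) !(adjointN (phi_defect_sym a)).
  rewrite !(adjointZ (phi_defect_sym a)) !innerE => e.
  by cinf_from (congr1 (fun u => eta b X * u) e).
(* In the argument slot, the extra [xi a] disappears because [S a (T a X) = 0]. *)
- move=> {X Y Z} X Y Z; rewrite pk !Asym innerDl innerNl innerZl -(Asym _ (xi a)).
  rewrite (cov_phi_defectE a X (xi a)) cov_defect_xi defect_nabla_xi_eq0 oppr0.
  by rewrite (endo0 (phi a)) inner0l mulr0 subr0.
Qed.

Lemma cov_defect_eq0 a X Y : cov nabla (S a) X Y = 0.
Proof.
apply: (phi_eta_eq0 (acm a)); last exact: eta_cov_defect.
by rewrite -cov_phi_defectE cov_phi_defect_eq0.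
Qed.

Lemma cov_nabla_xi a X Y :
  cov nabla (fun X => T a X) X Y = - (h *: cov nabla (phi a) X Y).
Proof. by apply/eqP; rewrite -addr_eq0 -cov_defect cov_defect_eq0. Qed.

Lemma nabla_xi_sqr a X : T a (T a X) = - (h *: phi a (T a X)).
Proof. by apply/eqP; rewrite -addr_eq0; exact/eqP/defect_nabla_xi_eq0. Qed.

(** * Relation with the distributions E^{4m} and E^{4l+3} *)

Lemma phi_defect_in_E4m a X p : in_E4m eta p (A a X).
Proof.
split=> [b|b Y]; rewrite (phi_defect_indep a b).
  by rewrite (eta_phi (acm b)).
rewrite (d1_T hnabla (qs b)) /A (T_phi hnabla (qs b)) -defect_nabla_xi.
by rewrite defect_nabla_xi_eq0 (endo0 (phi b)) inner0l addr0.
Qed.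

(** Puts [phi a (T a X)] in E^{4l+3}: test the condition that [d1 (eta a)] vanishes on [Y] at [p]
    against [phi a X]. *)
Lemma inner_phi_nabla_xi_E4m a X Y p :
  in_E4m eta p Y -> g (phi a (T a X)) Y p = 0.
Proof.
move=> [_ /(_ a (phi a X))]; rewrite (d1_T hnabla (qs a)).
have -> : g (T a Y) (phi a X) = - g (phi a (T a X)) Y.
  by rewrite (skewE (T_skew hnabla (qs a))) (T_phi hnabla (qs a)) inner_sym.
move=> e; have {e} : - (g (phi a (T a X)) Y p) - g (phi a (T a X)) Y p = 0 by [].
by rewrite -opprD => /eqP; rewrite oppr_eq0 -mulr2n mulrn_eq0 => /eqP.
Qed.

(** * Second covariant derivative of [phi a] and its curvature *)

Lemma nabla_phi_nabla_xi a X Y : nabla X (phi a (T a Y)) =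
  phi a (T a (nabla X Y)) - h *: (g (T a X) Y *: xi a + eta a Y *: T a X).
Proof.
rewrite (nabla_cov nabla (phi a)) (nabla_cov nabla (fun U => T a U)).
rewrite cov_nabla_xi !(cov_phi hnabla (qs a)) (eta_T hnabla (qs a)).
have -> : g (phi a (T a X)) (T a Y) = - (h * g (T a X) Y).
  rewrite inner_sym (skewE (T_skew hnabla (qs a))) (T_phi hnabla (qs a)).
  rewrite nabla_xi_sqr (endoN (phi a)) (endoZ (phi a)) (phi_phi (acm a)).
  rewrite (eta_T hnabla (qs a)) scale0r addr0 !innerE (inner_sym g Y).
  cinf_ring.
apply: (@inner_inj _ _ _ g) => W.
rewrite (endoD (phi a)) (endoN (phi a)) (endoZ (phi a)) (endoD (phi a)).
rewrite (endoN (phi a)) !(endoZ (phi a)) (phi_xi (acm a)) (phi_phi (acm a)).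
rewrite (eta_T hnabla (qs a)) !innerE.
cinf_ring.
Qed.

(** The parenthesised expression is the second covariant derivative of [phi a], obtained by
    differentiating [cov_phi]. *)
Lemma nabla_cov_phi a X Y Z : nabla X (cov nabla (phi a) Y Z) =
  cov nabla (phi a) Y (nabla X Z) + cov nabla (phi a) (nabla X Y) Z
  + (g (phi a (T a Y)) Z *: T a X - g (T a X) Z *: phi a (T a Y)
     - (h * eta a Y) *: (g (T a X) Z *: xi a - eta a Z *: T a X)).
Proof.
apply: (@inner_inj _ _ _ g) => W.
rewrite !(cov_phi hnabla (qs a)) -!(inner_xi (acm a)) !(nablaDl hnabla,
  nablaDr hnabla, nablaNr hnabla, nablaZr hnabla) !(nabla_inner hnabla).
rewrite !nabla_phi_nabla_xi !innerE -!(inner_xi (acm a)) (inner_sym g Z (T a X))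
  (inner_sym g Z (xi a)).
cinf_ring.
Qed.

(** The Ricci identity: antisymmetrising the second covariant derivative, the first-order terms
    cancel because [lie X Y] is the torsion-free bracket. *)
Lemma curvature_phi a X Y Z :
  curvature nabla X Y (phi a Z) - phi a (curvature nabla X Y Z) =
    (g (phi a (T a Y)) Z *: T a X - g (T a X) Z *: phi a (T a Y)
     - (h * eta a Y) *: (g (T a X) Z *: xi a - eta a Z *: T a X))
  - (g (phi a (T a X)) Z *: T a Y - g (T a Y) Z *: phi a (T a X)
     - (h * eta a X) *: (g (T a Y) Z *: xi a - eta a Z *: T a Y)).
Proof.
have covB U W : cov nabla (phi a) (U - W) Z =
    cov nabla (phi a) U Z - cov nabla (phi a) W Z.
  apply: (@inner_inj _ _ _ g) => W'.
  rewrite /cov !(nablaDl hnabla) !(nablaNl hnabla) (endoD (phi a)) (endoN (phi a)).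
  by rewrite !innerE; cinf_ring.
have nablaB U U' : nabla U (nabla U' (phi a Z)) = nabla U (cov nabla (phi a) U' Z)
    + (cov nabla (phi a) U (nabla U' Z) + phi a (nabla U (nabla U' Z))).
  by rewrite (nabla_cov nabla (phi a) U') [LHS](nablaDr hnabla)
             (nabla_cov nabla (phi a) U).
rewrite /curvature !nablaB !nabla_cov_phi (nabla_cov nabla (phi a)).
rewrite (lie_nabla hnabla) covB !(endoD (phi a)) !(endoN (phi a)).
apply: (@inner_inj _ _ _ g) => W; rewrite !innerE; cinf_ring.
Qed.

(** * Identification of [nabla X (xi a)] with a multiple of [psi a X] *)

Variable psi : 'I_3 -> endo_field M.
Hypothesis hpsi : forall a, is_psi g phi eta a (psi a).

Lemma psi_nabla_xi a X : T a X = - (h *: psi a X).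
Proof.
have [c0|c_neq0] := eqVneq c 0.
  have h0 : h = 0 by rewrite c0 mul0r; exact: (scale0r (1 : C)).
  have := nabla_xi_sqr a X; rewrite h0 !scale0r oppr0 => TT0.
  apply: (@inner_eq0 _ _ _ g).
  by rewrite (skewE (T_skew hnabla (qs a))) TT0 inner0r oppr0.
(* The inverse of [h]; [- q *: A a X] is the E^{4m}-component of [X], and [Q] below is its
   E^{4l+3}-component. *)
set q := constf M (2 / c).
have qh : q * h = 1 by rewrite -constfM -[RHS]constf1; congr constf; field.
have psiA : psi a (A a X) = 0.
  apply: vfieldE => f; apply: cinf_ext => p.
  by have [_ /(_ (phi_defect_in_E4m a X p) f)] := hpsi a p (A a X).
set Q := X + q *: A a X.
have QE : Q = q *: phi a (T a X) + eta a X *: xi a.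
  apply: (@inner_inj _ _ _ g) => W.
  rewrite /Q /A /S endoD endoZ (phi_phi (acm a)) !innerE.
  by cinf_from (congr1 (fun u => u * (eta a X * g (xi a) W - g X W)) qh).
(* [QE] exhibits [Q] through [phi a (T a X)] and [xi a], both orthogonal to E^{4m}, so [psi a]
   agrees with [phi a] on it. *)
have psiQ : psi a Q = phi a Q.
  apply: vfieldE => f; apply: cinf_ext => p.
  have [+ _] := hpsi a p Q; apply=> Y inY.
  rewrite QE !innerE (inner_sym g (xi a)) (inner_xi (acm a)).
  have {}inY1 := inner_phi_nabla_xi_E4m a X inY; case: inY => /(_ a) inY2 _.
  transitivity (q p * g (phi a (T a X)) Y p + eta a X p * eta a Y p) => //.
  by rewrite inY1 inY2 !mulr0 addr0.
have psiX : psi a X = phi a Q.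
  by rewrite -psiQ /Q endoD endoZ psiA scaler0 addr0.
rewrite psiX QE (endoD (phi a)) !(endoZ (phi a)) (phi_xi (acm a)) scaler0 addr0.
rewrite (phi_phi (acm a)) (eta_T hnabla (qs a)) scale0r addr0.
by rewrite scalerA mulrC qh scale1r opprK.
Qed.


End ThreeQuasiSasakian.

(** * Passage from the curvature formula to [psi] *)

Theorem theorem3p5 (R : realType) (n l : nat) (M : manifold R (4 * n + 3))
  (g : riemannian_metric M) (phi : 'I_3 -> endo_field M)
  (xi : 'I_3 -> vfield M) (eta : 'I_3 -> one_form M)
  (hM : three_quasi_sasakian g phi xi eta)
  (hrank : forall a, has_rank (eta a) (4 * l + 3))
  (c : R)
  (hc : forall a b k, even_triple a b k -> lie (xi a) (xi b) = constf M c *: xi k)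
  (psi : 'I_3 -> endo_field M) (hpsi : forall a, is_psi g phi eta a (psi a))
  (nabla : vfield M -> vfield M -> vfield M) (hnabla : levi_civita g nabla)
  (a : 'I_3) (X Y Z : vfield M) :
  let Rm := curvature nabla in
  let Psi := fundamental_form g (psi a) in
  Rm X Y (phi a Z) - phi a (Rm X Y Z) =
  constf M (c ^+ 2 / 4) *:
    ((Psi Y (psi a Z) - eta a Y * eta a Z) *: psi a X
     - (Psi X (psi a Z) - eta a X * eta a Z) *: psi a Y
     - Psi Y Z *: psi a (psi a X) + Psi X Z *: psi a (psi a Y)
     + (eta a X * Psi Y Z - eta a Y * Psi X Z) *: xi a).
Proof.
move=> Rm Psi; rewrite /Rm /Psi /fundamental_form.
have TE := psi_nabla_xi hnabla hM hc hpsi a.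
set h := constf M (c / 2) in TE.
have -> : constf M (c ^+ 2 / 4) = h * h.
  by rewrite -constfM; congr constf; field.
have [qs _] := hM; have [acm _ _] := qs a.
(* Identities for [psi a] are read off from those for [T a], so they carry powers of [h] that are
   never cancelled; this covers c = 0 as well. *)
have psi_anti U W : h * g (psi a U) W = - (h * g U (psi a W)).
  have := skewE (T_skew hnabla (qs a)) U W; rewrite !TE !innerE => e.
  by cinf_from (congr1 -%R e).
have phi_psi U W : h * h * g (phi a (psi a U)) W = h * h * g (psi a (psi a U)) W.
  have := congr1 (g^~ W) (nabla_xi_sqr hnabla hM hc a U).
  rewrite !TE (endoN (phi a)) (endoN (psi a)) (endoZ (phi a)) (endoZ (psi a)).
  by rewrite !innerE => e; cinf_from (esym e).
rewrite (curvature_phi hnabla hM hc); apply: (@inner_inj _ _ _ g) => W.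
rewrite !TE !(endoN (phi a)) !(endoZ (phi a)) !innerE.
rewrite -!/h.
have psi_psi U : h * h * g (phi a (psi a U)) Z = h * h * g U (psi a (psi a Z)).
  have e1 := congr1 (fun u => h * u) (psi_anti (psi a U) Z).
  have e2 := congr1 (fun u => - (h * u)) (psi_anti U (psi a Z)).
  by rewrite phi_psi; cinf_from (congr2 +%R e1 e2).
(* One half of the identity; the full one is the difference of this half and the same with [X] and
   [Y] exchanged. *)
have key U U' :
    (h * h * g (phi a (psi a U)) Z) * g (psi a U') W
    - g (psi a U') Z * (h * h * g (phi a (psi a U)) W)
    + h * eta a U * g (xi a) W * (h * g (psi a U') Z) =
    h * h * (g U (psi a (psi a Z)) * g (psi a U') W
      + g U' (psi a Z) * g (psi a (psi a U)) W
      - eta a U * g U' (psi a Z) * g (xi a) W).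
  rewrite psi_psi phi_psi psi_anti.
  by cinf_from (congr1 (fun u => - (u * h * g (psi a (psi a U)) W)) (psi_anti U' Z)).
by cinf_from (congr2 (fun u v => u - v) (key Y X) (key X Y)).
Qed.
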